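(* Let $n\ge 1$ be an integer, and let $p,\alpha,\lambda$ be real numbers such that either ($p>1$ and $0<\alpha<\frac{n+2}{2p}$) or ($p=1$ and $0<\alpha\le\frac{n+2}{2p}$), and such that $0<\lambda<1$. Let $T>0$ and $0<N<M$, where $$M=M(\alpha,\lambda)=\frac{\Gamma\left(\frac{\alpha\lambda}{1-\lambda}+1\right)}{\Gamma\left(\alpha+\frac{\alpha\lambda}{1-\lambda}+1\right)}$$ and $\Gamma$ is the Gamma function. Then there exists $$u\in Y^p_\alpha\cap C(\mathbb{R}^n\times\mathbb{R})$$ satisfying $$0\le(\partial_t-\Delta)^\alpha u\le u^\lambda\quad\text{in }\mathbb{R}^n\times\mathbb{R},\qquad u=0\quad\text{in }\mathbb{R}^n\times(-\infty,0)$$ such that $$(\partial_t-\Delta)^\alpha u\in L^p(\mathbb{R}^n\times\mathbb{R})\cap C(\mathbb{R}^n\times\mathbb{R}),$$ $$u(0,t)\ge(Nt^\alpha)^{\frac{1}{1-\lambda}}\quad\text{for }0<t<T,$$ and $$(\partial_t-\Delta)^\alpha u(0,t)=(Nt^\alpha)^{\frac{\lambda}{1-\lambda}}\quad\text{for }0<t<T.$$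
   Context: For $\alpha>0$ and $(x,t)\in\mathbb{R}^n\times\mathbb{R}$ let $$\Phi_\alpha(x,t)=\frac{t^{\alpha-1}}{\Gamma(\alpha)}\frac{1}{(4\pi t)^{n/2}}e^{-|x|^2/(4t)}\chi_{(0,\infty)}(t)$$ and $$J_\alpha f(x,t)=\iint_{\mathbb{R}^n\times(-\infty,t)}\Phi_\alpha(x-\xi,t-\tau)f(\xi,\tau)\,d\xi\,d\tau .$$ For $T\in\mathbb{R}$ put $\mathbb{R}_T=(-\infty,T)$. $X^p=\bigcap_{T\in\mathbb{R}}L^p(\mathbb{R}^n\times\mathbb{R}_T)$ is the set of all measurable $f:\mathbb{R}^n\times\mathbb{R}\to\mathbb{R}$ with $\|f\|_{L^p(\mathbb{R}^n\times\mathbb{R}_T)}<\infty$ for all $T\in\mathbb{R}$, and $Y^p_\alpha=J_\alpha(X^p)$. Functions equal almost everywhere are identified (a function said to be continuous is represented by its continuous representative, so its pointwise values are meaningful). When ($p>1$ and $0<\alpha<\frac{n+2}{2p}$) or ($p=1$ and $0<\alpha\le\frac{n+2}{2p}$), the integral defining $J_\alpha f$ yields a real-valued measurable function for each $f\in X^p$, the operator $J_\alpha:X^p\to Y^p_\alpha$ is one-to-one and onto, and $(\partial_t-\Delta)^\alpha:Y^p_\alpha\to X^p$ is defined to be its inverse. Since $(\partial_t-\Delta)^\alpha u\ge0$ forces $u\ge0$, the power $u^\lambda$ is meaningful. *)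

(* Defs.v *)
From HB Require Import structures.
From mathcomp Require Import all_boot all_order all_algebra.
From mathcomp Require Import all_classical all_reals all_analysis.

Set Implicit Arguments.
Unset Strict Implicit.
Unset Printing Implicit Defensive.
Import Order.TTheory GRing.Theory Num.Theory.
Import numFieldNormedType.Exports.
Local Open Scope classical_set_scope.
Local Open Scope ring_scope.

(* R^n is the space 'rV[R]_n, which already carries the product topology; it
   gets the sigma-algebra generated by the coordinates, i.e. the Borel one. *)
Section measurable_rV.
Context {d} {T : sigmaRingType d}.
Variable n : nat.

Let coors : 'I_n -> 'rV[T]_n -> T := fun i v => v ord0 i.

Let rV_set0 : g_sigma_preimage coors set0.
Proof. exact: sigma_algebra0. Qed.

Let rV_setC A : g_sigma_preimage coors A -> g_sigma_preimage coors (~` A).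
Proof. exact: sigma_algebraC. Qed.

Let rV_bigcup (F : _^nat) : (forall i, g_sigma_preimage coors (F i)) ->
  g_sigma_preimage coors (\bigcup_i (F i)).
Proof. exact: sigma_algebra_bigcup. Qed.

HB.instance Definition _ := @isMeasurable.Build (measure_tuple_display d)
  'rV[T]_n (g_sigma_preimage coors) rV_set0 rV_setC rV_bigcup.

End measurable_rV.

Lemma measurable_coord d (T : sigmaRingType d) n (i : 'I_n) :
  measurable_fun [set: 'rV[T]_n] (fun v : 'rV[T]_n => v ord0 i).
Proof.
move=> _ Y mY; rewrite setTI; apply: sub_sigma_algebra => /=.
rewrite -bigcup_seq/=; exists i => /=; first by rewrite mem_index_enum.
by exists Y => //; rewrite setTI.
Qed.

Lemma measurable_fun_rV d1 d2 (T1 : measurableType d1) (T2 : measurableType d2)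
    n (f : T1 -> 'rV[T2]_n) :
  (forall i, measurable_fun [set: T1] (fun x => f x ord0 i)) ->
  measurable_fun [set: T1] f.
Proof.
move=> mf _ A mA; rewrite setTI.
suff: (g_sigma_preimage (fun (i : 'I_n) x => f x ord0 i)) `<=` measurable.
  have -> : (fun (i : 'I_n) x => f x ord0 i) =
      (fun (i : 'I_n) => (fun v : 'rV[T2]_n => v ord0 i) \o f) by [].
  rewrite g_sigma_preimage_comp => /(_ (f @^-1` A)); apply.
  by exists A => //; rewrite setTI.
apply: smallest_sub; first exact: sigma_algebra_measurable.
rewrite -bigcup_seq/=; apply: bigcup_sub => i _ _ [B mB <-].
exact: mf.
Qed.

(* measurableTypeR R is R as the carrier on which the library declares
   lebesgue_measure. *)
Section lebesgue_rV.
Variable R : realType.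

Definition rV_cons n (z : measurableTypeR R * 'rV[R]_n) : 'rV[R]_n.+1 :=
  \row_i oapp (z.2 ord0) (z.1 : R) (unlift ord0 i).

Definition rV_uncons n (v : 'rV[R]_n.+1) : measurableTypeR R * 'rV[R]_n :=
  (v ord0 ord0, \row_j v ord0 (lift ord0 j)).

Lemma rV_consK n : cancel (@rV_cons n) (@rV_uncons n).
Proof.
move=> [a v]; rewrite /rV_uncons /rV_cons !mxE unlift_none/=; congr pair.
by apply/rowP => j; rewrite !mxE liftK.
Qed.

Lemma measurable_rV_cons n : measurable_fun setT (@rV_cons n).
Proof.
apply: measurable_fun_rV => i.
under eq_fun do rewrite mxE.
case: unliftP => [j|] _ /=.
  exact: (measurableT_comp (measurable_coord j) measurable_snd).
exact: measurable_fst.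
Qed.

Lemma measurable_rV_uncons n : measurable_fun setT (@rV_uncons n).
Proof.
apply/measurable_fun_pairP; split => /=.
  exact: (measurable_coord ord0).
apply: measurable_fun_rV => i /=.
under eq_fun do rewrite mxE.
exact: measurable_coord.
Qed.

Section step.
Local Open Scope ereal_scope.
Variables (n : nat) (mu : {sigma_finite_measure set 'rV[R]_n -> \bar R}).

Definition lebesgue_rV_step : set 'rV[R]_n.+1 -> \bar R :=
  pushforward (@lebesgue_measure R \x mu) (@rV_cons n).

Let step0 : lebesgue_rV_step set0 = 0.
Proof. by rewrite /lebesgue_rV_step /pushforward preimage_set0 measure0. Qed.

Let step_ge0 A : 0 <= lebesgue_rV_step A.
Proof. by rewrite /lebesgue_rV_step /pushforward measure_ge0. Qed.

Let step_sigma_additive : semi_sigma_additive lebesgue_rV_step.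
Proof.
move=> F mF tF mUF; rewrite /lebesgue_rV_step /pushforward preimage_bigcup.
have mpre A : measurable A -> measurable (@rV_cons n @^-1` A).
  by move=> mA; rewrite -[X in measurable X]setTI; exact: measurable_rV_cons.
apply: measure_semi_sigma_additive.
- by move=> k; exact: mpre.
- apply/trivIsetP => /= i j _ _ ij; rewrite -preimage_setI.
  by move/trivIsetP : tF => /(_ _ _ _ _ ij) ->//; rewrite preimage_set0.
- by rewrite -preimage_bigcup; exact: mpre.
Qed.

HB.instance Definition _ := isMeasure.Build _ _ _
  lebesgue_rV_step step0 step_ge0 step_sigma_additive.

Let step_sigma_finite : sigma_finite setT lebesgue_rV_step.
Proof.
have /sigma_finiteP[F [TF ndF Foo]] := sigma_finiteT (@lebesgue_measure R).
have /sigma_finiteP[G [TG ndG Goo]] := sigma_finiteT mu.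
exists (fun k => @rV_uncons n @^-1` (F k `*` G k)).
  rewrite -preimage_bigcup -(preimage_setT (@rV_uncons n)); congr preimage.
  rewrite -setXTT TF TG predeqE => -[x y]; split.
    move=> [/= [k _ Fkx] [l _ Gly]]; exists (maxn k l) => //; split.
    - by move: x Fkx; exact/subsetPset/ndF/leq_maxl.
    - by move: y Gly; exact/subsetPset/ndG/leq_maxr.
  by move=> [k _ []/= ? ?]; split; exists k.
move=> k; have [? ?] := Foo k; have [? ?] := Goo k; split.
  rewrite -[X in measurable X]setTI; apply: measurable_rV_uncons => //.
  exact: measurableX.
rewrite /lebesgue_rV_step /pushforward -comp_preimage.
rewrite (_ : _ \o _ = id); last by apply/funext => z; exact: rV_consK.
rewrite [X in (_ \x _) X](_ : _ = F k `*` G k)//.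
by rewrite product_measure1E// lte_mul_pinfty// ge0_fin_numE.
Qed.

HB.instance Definition _ := Measure_isSigmaFinite.Build _ _ _
  lebesgue_rV_step step_sigma_finite.

End step.

Fixpoint lebesgue_rV n : {sigma_finite_measure set 'rV[R]_n -> \bar R} :=
  if n is m.+1 then lebesgue_rV_step (lebesgue_rV m) else \d_(0 : 'rV[R]_0).

Lemma lebesgue_rV_box n (a b : 'rV[R]_n) : (forall i, a ord0 i <= b ord0 i) ->
  lebesgue_rV n [set v | forall i, v ord0 i \in `[a ord0 i, b ord0 i]] =
  (\prod_i (b ord0 i - a ord0 i))%:E.
Proof.
elim: n a b => [|n IHn] a b ab /=.
  by rewrite diracE big_ord0 mem_set// => -[].
pose tl (v : 'rV[R]_n.+1) : 'rV[R]_n := \row_j v ord0 (lift ord0 j).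
rewrite /lebesgue_rV_step /pushforward.
pose A : set (measurableTypeR R) := `[a ord0 ord0, b ord0 ord0]%classic.
pose B := [set v : 'rV[R]_n | forall i, v ord0 i \in `[tl a ord0 i, tl b ord0 i]].
have mB : measurable B.
  rewrite (_ : B = \bigcap_(i in [set: 'I_n])
      ((fun v : 'rV[R]_n => v ord0 i) @^-1` `[tl a ord0 i, tl b ord0 i])).
    apply: fin_bigcap_measurable => // i _.
    by rewrite -[X in measurable X]setTI; exact: measurable_coord.
  by apply/seteqP; split => v /= h i; [move=> _|]; exact: h.
transitivity ((@lebesgue_measure R \x lebesgue_rV n)%E (A `*` B)).
  congr ((_ \x _)%E _); apply/seteqP; split => -[x v] /=.
    move=> h; split; first by have := h ord0; rewrite mxE unlift_none.
    by move=> i; have := h (lift ord0 i); rewrite !mxE liftK.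
  move=> [hx hv] i; rewrite mxE; case: unliftP => [j|] -> //=.
  by have := hv j; rewrite !mxE.
rewrite product_measure1E//; last exact: measurable_itv.
rewrite IHn; last by move=> i; rewrite !mxE.
rewrite big_ord_recl EFinM; congr (_ * _)%E; last first.
  by congr EFin; apply: eq_bigr => i _; rewrite !mxE.
rewrite [LHS]lebesgue_measure_itv/= lte_fin.
by case: ltgtP (ab ord0) => // -> _; rewrite subrr.
Qed.

End lebesgue_rV.

Section fractional_heat.
Variables (R : realType) (n : nat).
Implicit Types (p alpha : R) (x : 'rV[R]_n) (t : R).
Implicit Types (u f : 'rV[R]_n * measurableTypeR R -> R).

Definition Gamma (a : R) : R :=
  \int[@lebesgue_measure R]_(s in `]0, +oo[) (s `^ (a - 1) * expR (- s)).

(* The norm of 'rV[R]_n is the sup norm, hence an explicit Euclidean one. *)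
Definition sqnorm x : R := \sum_i x ord0 i ^+ 2.

Definition Phi alpha x t : R :=
  t `^ (alpha - 1) / Gamma alpha * ((4 * pi * t) `^ (n%:R / 2))^-1 *
  expR (- (sqnorm x / (4 * t))) * \1_(`]0, +oo[ : set R) t.

Definition lebesgue_st :
    {measure set ('rV[R]_n * measurableTypeR R) -> \bar R} :=
  (lebesgue_rV R n \x @lebesgue_measure R)%E.

Definition before (T : R) : set ('rV[R]_n * measurableTypeR R) :=
  [set: 'rV[R]_n] `*` [set t : measurableTypeR R | (t : R) < T].

(* Extended-real valued: J alpha f z is a real number exactly when the
   integrand is integrable, since oo - oo = -oo for the Lebesgue integral. *)
Definition J alpha f (z : 'rV[R]_n * R) : \bar R :=
  (\int[lebesgue_st]_(w in before z.2)
     (Phi alpha (z.1 - w.1) (z.2 - w.2) * f w)%:E)%E.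

Definition Xspace p f : Prop :=
  measurable_fun setT f /\
  forall T : R, finite_norm lebesgue_st p%:E (f \_ (before T)).

(* is_frac_heat p alpha u f is the graph (d_t - Delta)^alpha u = f of the
   inverse of J alpha : X^p -> Y^p_alpha, functions being identified when they
   agree almost everywhere. *)
Definition is_frac_heat p alpha u f : Prop :=
  Xspace p f /\ {ae lebesgue_st, forall z, (u z)%:E = J alpha f z}.

Definition Yspace p alpha u : Prop := exists f, is_frac_heat p alpha u f.

End fractional_heat.

Definition Mconst (R : realType) (alpha lambda : R) : R :=
  Gamma (alpha * lambda / (1 - lambda) + 1) /
  Gamma (alpha + alpha * lambda / (1 - lambda) + 1).

(* Main.v *)
Require Import Defs.
From mathcomp Require Import all_boot all_order all_algebra.
From mathcomp Require Import all_classical all_reals all_analysis.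
From mathcomp Require Import measurable_realfun ring lra.

Set Implicit Arguments.
Unset Strict Implicit.
Unset Printing Implicit Defensive.
Import Order.TTheory GRing.Theory Num.Theory.
Import numFieldNormedType.Exports.
Local Open Scope classical_set_scope.
Local Open Scope ring_scope.

(** Take a source in which time and space separate and the space factor is a
    wide Gaussian:
      f(x, t) = (N t^alpha)^(lambda / (1 - lambda)) chi(t) e^(-|x|^2 / 4a)
    for t > 0, and f = 0 for t <= 0, where chi is a continuous nonincreasing
    cutoff equal to 1 up to time T and to 0 after time 2T.  The function sought
    is u = J_alpha f.

    The heat semigroup turns the Gaussian of parameter a into
      (a / (a + s))^(n/2) e^(-|x|^2 / 4(a + s)),
    which is at least (1 - n s / a) e^(-|x|^2 / 4a) ([heat_gauss_ge]).  For a
    large, diffusion over a time s < 2T therefore costs at most the factor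
    N / M < 1, and J_alpha f is bounded below by N / M times the Gaussian times
    a Riemann-Liouville integral of the time factor.  By the Euler Beta
    integral ([rlker_conv]) the Riemann-Liouville integral of order alpha of
    t^b, with b = alpha lambda / (1 - lambda), is exactly M t^(alpha + b), and
    alpha + b = alpha / (1 - lambda).  As chi is nonincreasing, it can be
    pulled out of the integral at its final value.  Altogether
      u(x, t) >= (N t^alpha)^(1 / (1 - lambda)) chi(t) e^(-|x|^2 / 4a).
    On the axis x = 0, before time T, this is the required lower bound.
    Everywhere, raising it to the power lambda gives u^lambda >= f, because a
    number y in [0, 1], here chi(t) e^(-|x|^2 / 4a), satisfies y <= y^lambda.

    The analytic facts about u come from the one-dimensional formula of
    [J_gauss], in which the space integral has been carried out: u is the
    integral of the locally integrable kernel s^(alpha - 1) / Gamma(alpha)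
    against a function that is jointly continuous in s and (x, t) and bounded,
    and that vanishes for s >= t.  Hence u is finite everywhere, continuous
    ([continuous_J_gauss]), and zero for negative times. *)

(** * Affine changes of variable on the line *)

Section affine.
Variable R : realType.
Notation mu := (@lebesgue_measure R).

Let aff (c d : R) : measurableTypeR R -> measurableTypeR R := fun x => c * x + d.

Let measurable_aff c d : measurable_fun setT (aff c d).
Proof. by apply: measurable_funD => //; apply: measurable_funM. Qed.

(** Both sides are integrals against measures that agree on half-open
    intervals; a negative [c] exchanges the two ends of an interval, hence the
    two cases. *)
Lemma ge0_integral_affine (c d : R) (h : measurableTypeR R -> \bar R) : c != 0 ->
  measurable_fun setT h -> (forall x, 0 <= h x)%E ->
  (\int[mu]_x h x = `|c|%:E * \int[mu]_x h (c * x + d)%R)%E.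
Proof.
move=> c0 mh h0.
have nc : 0 <= `|c| by [].
pose nu := mscale (NngNum nc) mu.
transitivity (\int[pushforward nu (aff c d)]_x h x)%E.
  apply: eq_measure_integral => A mA _.
  apply/lebesgue_measure_unique => //= _ [[a b]] _ <-.
  rewrite /pushforward /nu /mscale /=.
  have [cp|cn] : 0 < c \/ c < 0 by move: c0; case: ltgtP; auto.
    rewrite (_ : _ @^-1` _ = `](a - d) / c, (b - d) / c]%classic); last first.
      apply/seteqP; split => x /=; rewrite !in_itv /= /aff => /andP[].
        by rewrite ltr_pdivrMr// ler_pdivlMr// ltrBlDr lerBrDr ![x * _]mulrC => -> ->.
      by rewrite ltr_pdivrMr// ler_pdivlMr// ltrBlDr lerBrDr ![x * _]mulrC => -> ->.
    rewrite !lebesgue_measure_itv /= !lte_fin ltr_pM2r ?invr_gt0// ltrD2r.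
    case: ifPn => ab; last by rewrite mule0.
    by rewrite -!EFinB -EFinM gtr0_norm//; congr EFin; field.
  rewrite (_ : _ @^-1` _ = `[(b - d) / c, (a - d) / c[%classic); last first.
    apply/seteqP; split => x /=; rewrite !in_itv /= /aff => /andP[].
      by rewrite ltr_ndivlMr// ler_ndivrMr// ltrBlDr lerBrDr ![x * _]mulrC => -> ->.
    by rewrite ltr_ndivlMr// ler_ndivrMr// ltrBlDr lerBrDr ![x * _]mulrC => -> ->.
  rewrite !lebesgue_measure_itv /= !lte_fin ltr_nM2r ?invr_lt0// ltrD2r.
  case: ifPn => ab; last by rewrite mule0.
  by rewrite -!EFinB -EFinM ltr0_norm//; congr EFin; field.
rewrite ge0_integral_pushforward//= preimage_setT ge0_integral_mscale//=.
exact: (measurableT_comp mh (measurable_aff c d)).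
Qed.

Lemma ge0_integral_reflect (t : R) (h : measurableTypeR R -> \bar R) :
  measurable_fun setT h -> (forall x, 0 <= h x)%E ->
  (\int[mu]_x h x = \int[mu]_x h (t - x)%R)%E.
Proof.
move=> mh h0; rewrite (@ge0_integral_affine (-1) t)//.
rewrite normrN1 mul1e; apply: eq_integral => x _; congr h; ring.
Qed.

Lemma ge0_integral_shift (t : R) (h : measurableTypeR R -> \bar R) :
  measurable_fun setT h -> (forall x, 0 <= h x)%E ->
  (\int[mu]_x h x = \int[mu]_x h (x - t)%R)%E.
Proof.
move=> mh h0; rewrite (@ge0_integral_affine 1 (- t))//.
rewrite normr1 mul1e; apply: eq_integral => x _; congr h; ring.
Qed.

End affine.

(** * The Gamma integral *)

Section gamma.
Variable R : realType.
Notation mu := (@lebesgue_measure R).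
Implicit Types a b c s t x : R.

(** The Riemann-Liouville kernel of order [a] without its factor
    [1 / Gamma a].  Extended by 0 to the whole line, so that fractional
    integrals of functions supported in the positive half-line become
    convolutions over the line. *)
Definition rlker a s : R := s `^ (a - 1) * \1_(`]0, +oo[ : set R) s.

Lemma rlker_gt0E a s : 0 < s -> rlker a s = s `^ (a - 1).
Proof. by move=> s0; rewrite /rlker indicE mem_set ?mulr1//= in_itv/= andbT. Qed.

Lemma rlker_le0E a s : s <= 0 -> rlker a s = 0.
Proof.
by move=> s0; rewrite /rlker indicE memNset ?mulr0//= in_itv/= andbT ltNge s0.
Qed.

Lemma rlker_ge0 a s : 0 <= rlker a s.
Proof. by rewrite /rlker mulr_ge0// powR_ge0. Qed.

Lemma measurable_rlker a : measurable_fun setT (rlker a).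
Proof. by apply: measurable_funM => //; exact: measurable_powR. Qed.

Lemma rlkerM a c s : 0 < c -> rlker a (c * s) = c `^ (a - 1) * rlker a s.
Proof.
move=> c0; have [s0|s0] := ltP 0 s.
  by rewrite !rlker_gt0E ?mulr_gt0// powRM// ltW.
by rewrite !rlker_le0E ?mulr0// mulr_ge0_le0// ltW.
Qed.

Lemma integral_powR_itv a c : 0 < a -> 0 < c < 1 ->
  (\int[mu]_(s in `[c, 1%R]) (s `^ (a - 1))%:E = ((1 - c `^ a) / a)%:E)%E.
Proof.
move=> a0 /andP[c0 c1].
have dF x : 0 < x -> is_derive x 1 (fun x => a^-1 * x `^ a) (x `^ (a - 1)).
  move=> x0; have -> : x `^ (a - 1) = a^-1 * (a * x `^ (a - 1)).
    by rewrite mulrA mulVf ?mul1r// gt_eqF.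
  exact: (@is_deriveZ _ _ _ (@powR R ^~ a) a^-1 x 1 _ (is_derive1_powR a x0)).
have dP b x : 0 < x -> {for x, continuous (@powR R ^~ b)}.
  move=> x0; apply: differentiable_continuous; apply/derivable1_diffP.
  by apply: derivable_powR; rewrite in_itv/= andbT.
have cF x : 0 < x -> {for x, continuous (fun x => a^-1 * x `^ a)}.
  by move=> x0; apply: cvgM; [exact: cvg_cst|exact: dP].
rewrite (@continuous_FTC2 _ _ (fun x => a^-1 * x `^ a))//=.
- by rewrite powR1 -EFinB; congr EFin; ring.
- apply: continuous_in_subspaceT => x; rewrite inE/= in_itv/= => /andP[cx _].
  by apply: dP; rewrite (lt_le_trans c0).
- split.
  + move=> x; rewrite in_itv/= => /andP[cx _].
    by apply: ex_derive; apply: dF; rewrite (lt_trans c0).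
  + by apply: cvg_at_right_filter; apply: cF.
  + by apply: cvg_at_left_filter; apply: cF.
- move=> x; rewrite in_itv/= => /andP[cx _].
  by rewrite derive1E; apply: derive_val; apply: dF; rewrite (lt_trans c0).
Qed.

(** For [a < 1] the integrand is unbounded at 0, so the fundamental theorem of
    calculus applies only on the intervals [[1 / (n + 2), 1]]; monotone
    convergence passes their bound [1 / a] to the limit. *)
Lemma integral_powR_lty a : 0 < a ->
  (\int[mu]_(s in `]0%R, 1%R]) (s `^ (a - 1))%:E < +oo)%E.
Proof.
move=> a0.
pose F (n : nat) : set (measurableTypeR R) := `[n.+2%:R^-1, 1%R]%classic.
have mp (D : set (measurableTypeR R)) : measurable_fun D (fun s => (s `^ (a - 1))%:E).
  by apply/measurable_EFinP; apply: measurable_funTS; exact: measurable_powR.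
have -> : `]0%R, 1%R]%classic = \bigcup_n F n.
  apply/seteqP; split => x /=.
    rewrite in_itv/= => /andP[x0 x1].
    have [n xn] := ltr_add_invr x0; exists n => //.
    rewrite /F/= in_itv/= x1 andbT; move: xn; rewrite add0r => /ltW; apply: le_trans.
    by rewrite lef_pV2 ?posrE// ler_nat.
  move=> [n _]; rewrite /F/= !in_itv/= => /andP[nx ->]; rewrite andbT.
  by rewrite (lt_le_trans _ nx).
have cvgF : (\int[mu]_(s in F n) (s `^ (a - 1))%:E @[n --> \oo] -->
    \int[mu]_(s in \bigcup_n F n) (s `^ (a - 1))%:E)%E.
  apply: ge0_nondecreasing_set_cvg_integral => //.
  - apply/nondecreasing_seqP => n; apply/subsetPset => x; rewrite /F/=.
    rewrite !in_itv/= => /andP[nx ->]; rewrite andbT (le_trans _ nx)//.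
    by rewrite lef_pV2 ?posrE// ler_nat.
  - by move=> n; exact: measurable_itv.
  - by move=> n x _; rewrite lee_fin powR_ge0.
rewrite -(cvg_lim _ cvgF)//.
apply: (@le_lt_trans _ _ (a^-1)%:E); last exact: ltry.
apply: lime_le; first by apply/cvg_ex; eexists; exact: cvgF.
apply: nearW => n /=; rewrite integral_powR_itv//; last first.
  by rewrite invr_gt0 ltr0n/= invf_lt1 ?ltr1n.
rewrite lee_fin ler_pdivrMr// mulVf ?gt_eqF// gerBl; exact: powR_ge0.
Qed.


Let ga a s := rlker a s * expR (- s).

Let measurable_ga a : measurable_fun setT (ga a).
Proof.
apply: measurable_funM; first exact: measurable_rlker.
by apply: measurableT_comp.
Qed.

Let ga_ge0 a s : 0 <= ga a s.
Proof. by rewrite mulr_ge0// ?rlker_ge0// expR_ge0. Qed.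

(** From [y <= e^y] at [y = s / (2 a)], raised to the power [a]. *)
Lemma powR_le_expR a s : 0 < a -> 0 <= s ->
  s `^ a <= (2 * a) `^ a * expR (s / 2).
Proof.
move=> a0 s0; have a20 : 0 < 2 * a by rewrite mulr_gt0.
have {1}-> : s = 2 * a * (s / (2 * a)).
  by rewrite mulrCA divff ?mulr1// gt_eqF.
have a2ge := ltW a20; rewrite powRM ?divr_ge0// ler_wpM2l ?powR_ge0//.
have -> : s / 2 = s / (2 * a) * a by field; rewrite gt_eqF.
rewrite expRM ge0_ler_powR ?nnegrE ?expR_ge0 ?divr_ge0 ?(ltW a0)//.
by apply: ltW; rewrite (lt_le_trans _ (expR_ge1Dx _))// ltrDr.
Qed.

(** The singularity at 0 and the tail at infinity are dominated separately, by
    a power and by a multiple of the exponential density of rate [1 / 2]. *)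
Lemma Gamma_integrand_le a s : 0 < a ->
  rlker a s * expR (- s) <= s `^ (a - 1) * \1_(`]0, 1] : set R) s +
    2 * (2 * a) `^ a * exponential_pdf (2^-1) s.
Proof.
move=> a0.
have r0 : 0 <= 2 * (2 * a) `^ a * exponential_pdf 2^-1 s.
  by rewrite mulr_ge0 ?mulr_ge0 ?powR_ge0// exponential_pdf_ge0.
have [s0|s0] := leP s 0.
  by rewrite rlker_le0E// mul0r addr_ge0// mulr_ge0 ?powR_ge0.
rewrite rlker_gt0E//; have [s1|s1] := leP s 1.
  rewrite indicE mem_set ?mulr1/= ?in_itv/= ?s0//.
  by rewrite -[leLHS]addr0 lerD// ler_piMr ?powR_ge0// -expR0 ler_expR oppr_le0 ltW.
rewrite indicE memNset/=; last by rewrite in_itv/= s0/= leNgt s1.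
rewrite mulr0 add0r.
rewrite exponential_pdfE ?(ltW s0)// [leRHS](_ : _ =
    (2 * a) `^ a * expR (s / 2) * expR (- s)); last first.
  have -> : - 2^-1 * s = s / 2 + - s by field.
  by rewrite expRD; field.
rewrite ler_wpM2r ?expR_ge0//; apply: le_trans (powR_le_expR a0 (ltW s0)).
by apply: ler_powR; [exact: ltW|rewrite gerBl].
Qed.

Lemma integral_Gamma_lty a : 0 < a ->
  (\int[mu]_s (rlker a s * expR (- s))%:E < +oo)%E.
Proof.
move=> a0; have c0 : 0 <= 2 * (2 * a) `^ a by rewrite mulr_ge0// powR_ge0.
have m1 : measurable_fun [set: measurableTypeR R]
    (fun s => (s `^ (a - 1) * \1_(`]0, 1] : set R) s)%:E).
  apply/measurable_EFinP; apply: measurable_funM.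
    exact: measurable_powR.
  by apply: measurable_indic; exact: measurable_itv.
have m2 : measurable_fun [set: measurableTypeR R]
    (fun s => (exponential_pdf (2^-1) s)%:E).
  by apply/measurable_EFinP; exact: measurable_exponential_pdf.
apply: (@le_lt_trans _ _ (\int[mu]_s ((s `^ (a - 1) * \1_(`]0, 1] : set R) s)%:E +
    (2 * (2 * a) `^ a)%:E * (exponential_pdf (2^-1) s)%:E))%E).
  apply: ge0_le_integral => //.
  - by move=> s _; rewrite lee_fin; exact: ga_ge0.
  - by apply/measurable_EFinP; exact: measurable_ga.
  - by apply: emeasurable_funD => //; apply: measurable_funeM.
  - by move=> s _; rewrite -EFinM -EFinD lee_fin; exact: Gamma_integrand_le.
rewrite ge0_integralD//=; last 3 first.
- by move=> s _; rewrite lee_fin mulr_ge0 ?powR_ge0.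
- by move=> s _; rewrite -EFinM lee_fin mulr_ge0// exponential_pdf_ge0.
- exact: measurable_funeM.
rewrite ge0_integralZl//; last by move=> s _; rewrite lee_fin exponential_pdf_ge0.
rewrite integral_exponential_pdf ?invr_gt0// mule1 lte_add_pinfty ?ltry//.
have := integral_powR_lty a0; rewrite integral_mkcond; congr (_ < _)%E.
apply: eq_integral => s _; rewrite patchE indicE; case: ifPn => _;
  by rewrite ?mulr1 ?mulr0.
Qed.

(** [Gamma] is defined as a real number, which would be 0 if the integral
    diverged; finiteness makes it a true value of the extended integral. *)
Lemma Gamma_integral a : 0 < a ->
  (\int[mu]_s (rlker a s * expR (- s))%:E = (Gamma a)%:E)%E.
Proof.
move=> a0; rewrite /Gamma /Rintegral [in RHS]integral_mkcond.
rewrite (_ : _ \_ _ = fun s => (rlker a s * expR (- s))%:E); last first.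
  apply/funext => s; rewrite patchE /rlker indicE; case: ifPn => _;
    by rewrite ?mulr1 ?mulr0 ?mul0r.
rewrite fineK// ge0_fin_numE ?integral_Gamma_lty// integral_ge0// => s _.
by rewrite lee_fin; exact: ga_ge0.
Qed.

Lemma Gamma_gt0 a : 0 < a -> 0 < Gamma a.
Proof.
move=> a0; rewrite -lte_fin -Gamma_integral//.
(* On [1, 2] the integrand is at least [s^-1 * e^-2], because [s^a >= 1]. *)
apply: (@lt_le_trans _ _ (\int[mu]_(s in `[1%R, 2%R]) (expR (- 2) / 2)%:E)%E).
  rewrite integral_cst//= lebesgue_measure_itv/= lte_fin ltr1n -EFinB -EFinM.
  by rewrite lte_fin mulr_gt0 ?mulr_gt0 ?expR_gt0// subr_gt0 ltr1n.
rewrite integral_mkcond; apply: ge0_le_integral => //.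
- by move=> s _; apply: erestrict_ge0 => x _; rewrite lee_fin divr_ge0 ?expR_ge0.
- by apply/(measurable_restrictT _ _).1 => //; exact: measurable_cst.
- by apply/measurable_EFinP; exact: measurable_ga.
- move=> s _; rewrite patchE; case: ifPn => [|_]; last by rewrite lee_fin ga_ge0.
  rewrite inE/= in_itv/= lee_fin => /andP[s1 s2].
  have s0 : 0 < s by rewrite (lt_le_trans _ s1).
  rewrite rlker_gt0E// mulrC ler_pM ?expR_ge0 ?ler_expR ?lerN2//.
  apply: (@le_trans _ _ (s ^-1)); first by rewrite lef_pV2 ?posrE.
  rewrite -(powR_inv1 (ltW s0)); apply: ler_powR => //.
  by rewrite lerBrDr addrC subrr ltW.
Qed.

End gamma.

(** * The Beta integral *)

Section beta.
Variable R : realType.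
Notation mu := (@lebesgue_measure R).
Implicit Types a b s t x y : R.

Let measurable_rlker_conv a b t :
  measurable_fun [set: measurableTypeR R] (fun s => (rlker a (t - s) * rlker b s)%:E).
Proof.
apply/measurable_EFinP; apply: measurable_funM; last exact: measurable_rlker.
apply: (measurableT_comp (measurable_rlker a)).
by apply: measurable_funB.
Qed.

Let B a b := (\int[mu]_s (rlker a (1 - s) * rlker b s)%:E)%E.

(** Homogeneity: the substitution of [t * s] for [s] reduces the convolution
    at time [t] to the one at time 1. *)
Let rlker_conv_scale a b t :
  (\int[mu]_s (rlker a (t - s) * rlker b s)%:E = (rlker (a + b) t)%:E * B a b)%E.
Proof.
have [t0|t0] := leP t 0.
  rewrite rlker_le0E// mul0e integral0_eq// => s _.
  have [s0|s0] := leP s 0; first by rewrite [X in _ * X]rlker_le0E// mulr0.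
  by rewrite rlker_le0E ?mul0r// subr_le0 (le_trans t0)// ltW.
rewrite (@ge0_integral_affine _ t 0) ?gt_eqF//; last first.
  by move=> s; rewrite lee_fin mulr_ge0// rlker_ge0.
transitivity (`|t|%:E * \int[mu]_s ((t `^ (a - 1) * t `^ (b - 1))%:E *
    (rlker a (1 - s) * rlker b s)%:E))%E.
  congr (_ * _)%E; apply: eq_integral => s _.
  rewrite addr0 (_ : t - t * s = t * (1 - s)); last by ring.
  by rewrite !rlkerM// -EFinM; congr EFin; ring.
rewrite ge0_integralZl//; last first.
- by rewrite lee_fin mulr_ge0// powR_ge0.
- by move=> s _; rewrite lee_fin mulr_ge0// rlker_ge0.
rewrite muleA -EFinM rlker_gt0E// gtr0_norm//; congr (_%:E * _)%E.
have tn0 : t != 0 by rewrite gt_eqF.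
rewrite -{1}(powRr1 (ltW t0)) -!powRD ?tn0 ?implybT//.
by congr (_ `^ _); ring.
Qed.

(** Euler's formula for the Beta integral, written as the semigroup property
    of Riemann-Liouville kernels.  The product of two Gamma integrals is a
    double integral; a shift and Tonelli's theorem rewrite it as the integral
    over [x] of [e^(-x)] times the convolution at [x], which by homogeneity is
    the Beta integral times [Gamma (a + b)]. *)
Lemma rlker_conv a b t : 0 < a -> 0 < b ->
  (\int[mu]_s (rlker a (t - s) * rlker b s)%:E =
   (rlker (a + b) t * (Gamma a * Gamma b / Gamma (a + b)))%:E)%E.
Proof.
move=> a0 b0; have ab0 : 0 < a + b by rewrite addr_gt0.
pose ga a s := rlker a s * expR (- s).
have mga c : measurable_fun [set: measurableTypeR R] (ga c).
  apply: measurable_funM; first exact: measurable_rlker.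
  by apply: measurableT_comp.
have ga0 c s : 0 <= ga c s by rewrite mulr_ge0 ?rlker_ge0 ?expR_ge0.
suff BE : ((Gamma a * Gamma b)%:E = B a b * (Gamma (a + b))%:E)%E.
  have G0 := Gamma_gt0 ab0.
  rewrite rlker_conv_scale (EFinM (rlker _ _)) (EFinM (Gamma a * Gamma b)) BE
    -muleA -EFinM divff ?mule1//.
  by rewrite gt_eqF.
rewrite EFinM -!Gamma_integral// -/(ga a) muleC.
rewrite -ge0_integralZr//; last 3 first.
- by apply/measurable_EFinP; exact: mga.
- by move=> s _; rewrite lee_fin ga0.
- by apply: integral_ge0 => s _; rewrite lee_fin ga0.
transitivity (\int[mu]_y \int[mu]_x (ga b y * ga a (x - y))%:E)%E.
  apply: eq_integral => y _.
  rewrite (@ge0_integral_shift _ y); last 2 first.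
  - by apply/measurable_EFinP; exact: mga.
  - by move=> s; rewrite lee_fin ga0.
  under [RHS]eq_integral do rewrite EFinM.
  rewrite ge0_integralZl// ?lee_fin ?ga0//.
  - apply/measurable_EFinP; apply: (measurableT_comp (mga a)).
    by apply: measurable_funB.
  - by move=> s _; rewrite lee_fin ga0.
rewrite (fubini_tonelli (fun z : measurableTypeR R * measurableTypeR R =>
    (ga b z.1 * ga a ((z.2 : R) - z.1))%:E))/=; last 2 first.
- apply/measurable_EFinP; apply: measurable_funM.
    exact: (measurableT_comp (mga b)).
  apply: (measurableT_comp (mga a)); exact: measurable_funB.
- by move=> z; rewrite lee_fin mulr_ge0// ga0.
transitivity (\int[mu]_x (B a b * (ga (a + b) x)%:E))%E; last first.
  rewrite ge0_integralZl//.
  - by apply/measurable_EFinP; exact: mga.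
  - by move=> s _; rewrite lee_fin ga0.
  - by apply: integral_ge0 => s _; rewrite lee_fin mulr_ge0// rlker_ge0.
apply: eq_integral => x _.
transitivity (\int[mu]_y ((expR (- x))%:E * (rlker a (x - y) * rlker b y)%:E))%E.
  apply: eq_integral => y _; rewrite -EFinM /ga; congr EFin.
  have -> : - x = - y + - (x - y) by ring.
  by rewrite expRD; ring.
rewrite ge0_integralZl//; last first.
  by move=> s _; rewrite lee_fin mulr_ge0// rlker_ge0.
by rewrite rlker_conv_scale muleA -EFinM muleC mulrC.
Qed.

End beta.

(** * Gaussian integrals on the space of row vectors *)

Section gauss_rV.
Variable R : realType.
Notation mu := (@lebesgue_measure R).
Implicit Types a s x y m v : R.

Lemma measurable_rV_prod n (h : 'I_n -> R -> R) :
  (forall i, measurable_fun setT (h i)) ->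
  measurable_fun setT (fun v : 'rV[R]_n => \prod_i h i (v ord0 i)).
Proof.
move=> mh; apply: measurable_prod => i _.
exact: (measurableT_comp (mh i) (measurable_coord i)).
Qed.

(** Induction on the dimension: the Lebesgue measure on [n.+1] coordinates is
    the image of a product measure, to which Tonelli's theorem applies.  The
    values [c] are real, which keeps the product free of the indeterminate
    [0 * +oo]. *)
Lemma integral_rV_prod n (h : 'I_n -> R -> R) (c : 'I_n -> R) :
  (forall i, measurable_fun setT (h i)) -> (forall i x, 0 <= h i x) ->
  (forall i, \int[mu]_x (h i x)%:E = (c i)%:E)%E ->
  (\int[lebesgue_rV R n]_v (\prod_i h i (v ord0 i))%:E = (\prod_i c i)%:E)%E.
Proof.
elim: n h c => [|n IHn] h c mh h0 hc.
  rewrite /= integral_dirac//; first by rewrite diracT mul1e !big_ord0.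
  by apply/measurable_EFinP; exact: measurable_rV_prod.
have m1 := measurable_rV_prod mh.
have m2 := measurable_rV_prod (fun i => mh (lift ord0 i)).
rewrite /= /lebesgue_rV_step ge0_integral_pushforward//; last 3 first.
- exact: measurable_rV_cons.
- exact/measurable_EFinP.
- by move=> v _; rewrite lee_fin prodr_ge0.
rewrite preimage_setT.
have E z : \prod_i h i (@rV_cons R n z ord0 i) =
    h ord0 z.1 * \prod_i h (lift ord0 i) (z.2 ord0 i).
  rewrite big_ord_recl mxE unlift_none; congr (_ * _).
  by apply: eq_bigr => i _; rewrite mxE liftK.
rewrite (eq_integral (fun z : measurableTypeR R * 'rV[R]_n => (h ord0 z.1)%:E *
    (\prod_i h (lift ord0 i) (z.2 ord0 i))%:E)%E); last first.
  by move=> z _; rewrite /= E EFinM.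
rewrite fubini_tonelli1/=; last 2 first.
- apply: emeasurable_funM; apply/measurable_EFinP.
    exact: (measurableT_comp (mh ord0)).
  exact: (measurableT_comp m2).
- by move=> z; rewrite mule_ge0// lee_fin// prodr_ge0.
rewrite /fubini_F/=.
under eq_integral => x _.
  rewrite ge0_integralZl ?lee_fin//; last 2 first.
  - exact/measurable_EFinP.
  - by move=> v _; rewrite lee_fin prodr_ge0.
  rewrite (IHn (fun i => h (lift ord0 i)) (fun i => c (lift ord0 i)))//.
  over.
rewrite /= ge0_integralZr//; last 3 first.
- by apply/measurable_EFinP; exact: mh.
- by move=> x _; rewrite lee_fin.
- rewrite lee_fin prodr_ge0// => i _; rewrite -lee_fin -hc.
  by apply: integral_ge0 => x _; rewrite lee_fin.
by rewrite hc -EFinM big_ord_recl.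
Qed.

(** A multiple of the normal density of mean [m] and variance [2 v]. *)
Lemma integral_gauss m v : 0 < v ->
  (\int[mu]_y (expR (- ((y - m) ^+ 2 / (4 * v))))%:E = (Num.sqrt (4 * pi * v))%:E)%E.
Proof.
move=> v0; pose sg := Num.sqrt (2 * v).
have sg0 : sg != 0 by rewrite gt_eqF// sqrtr_gt0 mulr_gt0.
have sg2 : sg ^+ 2 = 2 * v by rewrite sqr_sqrtr// mulr_ge0// ltW.
have p0 : 0 < Num.sqrt (4 * pi * v) by rewrite sqrtr_gt0 !mulr_gt0// pi_gt0.
transitivity (\int[mu]_y ((Num.sqrt (4 * pi * v))%:E * (normal_pdf m sg y)%:E))%E.
  apply: eq_integral => y _; rewrite normal_pdfE// /normal_peak /normal_fun -EFinM.
  rewrite sg2 mulrA (_ : 2 * v * pi *+ 2 = 4 * pi * v); last by ring.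
  rewrite divff ?mul1r ?gt_eqF//; congr (expR _)%:E.
  by field; rewrite gt_eqF.
rewrite ge0_integralZl//; last 2 first.
- by apply/measurable_EFinP; exact: measurable_normal_pdf.
- by move=> y _; rewrite lee_fin normal_pdf_ge0.
by rewrite integral_normal_pdf mule1.
Qed.

(** Completing the square: the product of the two exponentials, as a function
    of [y], is a constant times a Gaussian of parameter [a s / (a + s)]
    centred at [a x / (a + s)]. *)
Lemma integral_gauss_conv a s x : 0 < a -> 0 < s ->
  (\int[mu]_y ((Num.sqrt (4 * pi * s))^-1 * expR (- ((x - y) ^+ 2 / (4 * s))) *
     expR (- (y ^+ 2 / (4 * a))))%:E =
   (Num.sqrt (a / (a + s)) * expR (- (x ^+ 2 / (4 * (a + s)))))%:E)%E.
Proof.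
move=> a0 s0; have as0 : 0 < a + s by rewrite addr_gt0.
have [an0 sn0 asn0] : [/\ a != 0, s != 0 & a + s != 0] by rewrite !gt_eqF.
pose v := a * s / (a + s); pose m := a * x / (a + s).
have v0 : 0 < v by rewrite divr_gt0// mulr_gt0.
have p0 : 0 < 4 * pi * s by rewrite !mulr_gt0// pi_gt0.
have q0 : 0 < Num.sqrt (4 * pi * s) by rewrite sqrtr_gt0.
pose K := (Num.sqrt (4 * pi * s))^-1 * expR (- (x ^+ 2 / (4 * (a + s)))).
transitivity (\int[mu]_y (K%:E * (expR (- ((y - m) ^+ 2 / (4 * v))))%:E))%E.
  apply: eq_integral => y _; rewrite -EFinM /K; congr EFin.
  rewrite -!mulrA -!expRD; congr (_ * expR _).
  by rewrite /m /v; field; rewrite an0 sn0 asn0.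
rewrite ge0_integralZl//; last 2 first.
- apply/measurable_EFinP; apply: measurableT_comp => //.
  apply: measurable_funN; apply: measurable_funM => //.
  by apply: measurable_funX; exact: measurable_funB.
- by rewrite lee_fin mulr_ge0 ?expR_ge0// invr_ge0 ltW.
rewrite integral_gauss// -EFinM /K; congr EFin.
rewrite (_ : 4 * pi * v = (4 * pi * s) * (a / (a + s))); last first.
  by rewrite /v; field.
by rewrite (sqrtrM _ (ltW p0)) mulrACA mulVf ?gt_eqF// mul1r mulrC.
Qed.

End gauss_rV.

(** * The fractional heat potential of a Gaussian source *)

Section heat_potential.
Variables (R : realType) (n : nat).
Notation mu := (@lebesgue_measure R).
Implicit Types (a s t alpha : R) (x xi : 'rV[R]_n) (g : R -> R).

(** The solution at time [s] of the heat equation with initial datum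
    [e^(-|x|^2 / 4a)]. *)
Definition heat_gauss a x s : R :=
  Num.sqrt (a / (a + s)) ^+ n * expR (- (sqnorm x / (4 * (a + s)))).

Lemma measurable_inv : measurable_fun setT (@GRing.inv R).
Proof.
rewrite -(setUv [set (0 : R)]); apply/measurable_funU => //.
  exact: measurableC.
split; first exact: measurable_fun_set1.
apply: open_continuous_measurable_fun.
  by apply: closed_openC; exact: closed_eq.
by move=> y; rewrite inE/= => /eqP y0; exact: inv_continuous.
Qed.

Lemma measurable_sqnorm : measurable_fun setT (@sqnorm R n).
Proof.
apply: measurable_sum => i; apply: measurable_funX; exact: measurable_coord.
Qed.

Lemma measurable_sqnorm_sub x : measurable_fun setT (fun xi => sqnorm (x - xi)).
Proof.
apply: measurable_sum => i; apply: measurable_funX.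
rewrite (_ : (fun _ => _) = (fun xi => x ord0 i - xi ord0 i)).
  by apply: measurable_funB => //; exact: measurable_coord.
by apply/funext => xi; rewrite !mxE.
Qed.

Lemma heat_gauss_ge0 a x s : 0 <= heat_gauss a x s.
Proof. by rewrite mulr_ge0 ?expR_ge0// exprn_ge0// sqrtr_ge0. Qed.

Lemma measurable_heat_gauss a x : measurable_fun setT (heat_gauss a x).
Proof.
have mas : measurable_fun setT (fun s : R => a + s) by exact: measurable_funD.
apply: measurable_funM.
  apply: measurable_funX.
  apply: (measurableT_comp (continuous_measurable_fun (@sqrt_continuous R))).
  apply: measurable_funM => //; exact: (measurableT_comp measurable_inv).
apply: measurableT_comp => //; apply: measurable_funN; apply: measurable_funM => //.
by apply: (measurableT_comp measurable_inv); exact: measurable_funM.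
Qed.

(** The heat kernel and the Gaussian are products over the coordinates, so the
    one-dimensional convolution suffices. *)
Lemma integral_heat_gauss a s x : 0 < a -> 0 < s ->
  (\int[lebesgue_rV R n]_xi
     (((4 * pi * s) `^ (n%:R / 2))^-1 * expR (- (sqnorm (x - xi) / (4 * s))) *
      expR (- (sqnorm xi / (4 * a))))%:E = (heat_gauss a x s)%:E)%E.
Proof.
move=> a0 s0; have p0 : 0 < 4 * pi * s by rewrite !mulr_gt0// pi_gt0.
pose c i := Num.sqrt (a / (a + s)) * expR (- (x ord0 i ^+ 2 / (4 * (a + s)))).
pose h (i : 'I_n) y := (Num.sqrt (4 * pi * s))^-1 *
  expR (- ((x ord0 i - y) ^+ 2 / (4 * s))) * expR (- (y ^+ 2 / (4 * a))).
have prodE (k : R) b (F : 'I_n -> R) :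
    \prod_i (k * expR (- (F i / b))) = k ^+ n * expR (- ((\sum_i F i) / b)).
  rewrite big_split/= prodr_const card_ord; congr (_ * _).
  by rewrite -expR_sum sumrN mulr_suml.
rewrite (_ : heat_gauss a x s = \prod_i c i); last by rewrite prodE.
rewrite -(@integral_rV_prod _ _ h c)//; last first.
- by move=> i; exact: integral_gauss_conv.
- by move=> i y; rewrite !mulr_ge0 ?expR_ge0// invr_ge0 sqrtr_ge0.
- move=> i; apply: measurable_funM; last first.
    apply: measurableT_comp => //; apply: measurable_funN.
    by apply: measurable_funM => //; exact: measurable_funX.
  apply: measurable_funM => //; apply: measurableT_comp => //.
  apply: measurable_funN; apply: measurable_funM => //; apply: measurable_funX.
  exact: measurable_funB.
apply: eq_integral => xi _; congr EFin.
rewrite /h big_split/= prodE; congr (_ * _ * _); last first.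
- have := prodE 1 (4 * a) (fun i => xi ord0 i ^+ 2).
  by under eq_bigr do rewrite mul1r; rewrite expr1n mul1r.
- rewrite (_ : sqnorm (x - xi) = \sum_i (x ord0 i - xi ord0 i) ^+ 2)//.
  by apply: eq_bigr => i _; rewrite !mxE.
- by rewrite exprVn -powR12_sqrt ?(ltW p0)// -powR_mulrn ?powR_ge0// -powRrM (mulrC n%:R).
Qed.

Definition gauss_source a g (w : 'rV[R]_n * measurableTypeR R) : R :=
  g w.2 * expR (- (sqnorm w.1 / (4 * a))).

(** Tonelli's theorem: for each elapsed time [s = t - tau] the inner integral
    over space is the heat evolution of the Gaussian, and what remains is an
    integral over [s] alone. *)
Lemma J_gauss alpha a g x t : 0 < alpha -> 0 < a ->
  measurable_fun setT g -> (forall s, 0 <= g s) ->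
  (J alpha (gauss_source a g) (x, t) =
   \int[mu]_s (rlker alpha s / Gamma alpha * (g (t - s) * heat_gauss a x s))%:E)%E.
Proof.
move=> al0 a0 mg g0; have G0 := Gamma_gt0 al0.
pose q s : R := (4 * pi * s) `^ (n%:R / 2).
pose hk xi s : R := (q s)^-1 * expR (- (sqnorm (x - xi) / (4 * s))).
pose F (w : 'rV[R]_n * measurableTypeR R) : R :=
  (rlker alpha (t - w.2) / Gamma alpha * g w.2) *
  (hk w.1 (t - w.2) * expR (- (sqnorm w.1 / (4 * a)))).
have q0 s : 0 <= q s by exact: powR_ge0.
have rl0 := @rlker_ge0 R alpha.
have F0 w : 0 <= F w.
  apply: mulr_ge0; first by apply: mulr_ge0 => //; rewrite divr_ge0// ltW.
  by rewrite mulr_ge0 ?expR_ge0// mulr_ge0 ?expR_ge0// invr_ge0.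
have msub : measurable_fun setT (fun s : R => t - s) by exact: measurable_funB.
have mr : measurable_fun setT (fun s : R => rlker alpha (t - s) / Gamma alpha * g s).
  apply: measurable_funM => //; apply: measurable_funM => //.
  exact: (measurableT_comp (measurable_rlker alpha)).
have mF : measurable_fun setT F.
  have m1 : measurable_fun setT (fst : 'rV[R]_n * measurableTypeR R -> _).
    exact: measurable_fst.
  have m2 : measurable_fun setT (snd : 'rV[R]_n * measurableTypeR R -> _).
    exact: measurable_snd.
  have m2' := measurableT_comp msub m2.
  have msq := measurableT_comp measurable_sqnorm m1.
  apply: measurable_funM; first exact: (measurableT_comp mr m2).
  apply: measurable_funM; last first.
    apply: measurableT_comp => //; apply: measurable_funN.
    exact: measurable_funM.
  apply: measurable_funM.
    apply: (measurableT_comp measurable_inv); apply: (measurableT_comp (measurable_powR _)).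
    exact: measurable_funM.
  apply: measurableT_comp => //; apply: measurable_funN; apply: measurable_funM.
    exact: (measurableT_comp (measurable_sqnorm_sub x) m1).
  apply: (measurableT_comp measurable_inv); exact: measurable_funM.
(* The kernel vanishes for nonpositive elapsed times, so the domain of
   integration can be enlarged to the whole space-time. *)
transitivity (\int[lebesgue_st R n]_w (F w)%:E)%E.
  rewrite /J integral_mkcond; apply: eq_integral => w _.
  rewrite patchE/= /F /hk /q.
  have [tw|tw] := ltP (w.2 : R) t.
    rewrite ifT; last by rewrite inE /before.
    rewrite /Phi /rlker /gauss_source /=; congr EFin.
    ring.
  rewrite ifF; last by apply/negP; rewrite inE /before/= => -[_]; rewrite /= ltNge tw.
  by rewrite rlker_le0E ?subr_le0// !mul0r.
rewrite /lebesgue_st fubini_tonelli2; last 2 first.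
- exact/measurable_EFinP.
- by move=> w; rewrite lee_fin.
rewrite (@ge0_integral_reflect _ t); last 2 first.
- apply/measurable_EFinP; apply: measurable_funM.
    by apply: measurable_funM => //; exact: measurable_rlker.
  by apply: measurable_funM; [exact: measurableT_comp|exact: measurable_heat_gauss].
- move=> s; rewrite lee_fin; apply: mulr_ge0; first by rewrite divr_ge0// ltW.
  by apply: mulr_ge0 => //; exact: heat_gauss_ge0.
apply: eq_integral => s _; rewrite /fubini_G/= /F/=.
under eq_integral do rewrite EFinM.
have [ts|ts] := leP t s.
  rewrite [in RHS]rlker_le0E ?subr_le0// !mul0r.
  by rewrite integral0_eq// => xi _; rewrite rlker_le0E ?subr_le0// !mul0r mul0e.
rewrite ge0_integralZl//; last 3 first.
- apply/measurable_EFinP; apply: measurable_funM.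
    apply: measurable_funM => //; apply: measurableT_comp => //.
    apply: measurable_funN; apply: measurable_funM => //.
    exact: measurable_sqnorm_sub.
  apply: measurableT_comp => //; apply: measurable_funN; apply: measurable_funM => //.
  exact: measurable_sqnorm.
- move=> xi _; rewrite lee_fin; apply: mulr_ge0; last exact: expR_ge0.
  by apply: mulr_ge0; [rewrite invr_ge0|exact: expR_ge0].
- by rewrite lee_fin mulr_ge0// divr_ge0// ltW.
rewrite /hk integral_heat_gauss ?subr_gt0// -EFinM; congr EFin.
rewrite (_ : t - (t - s) = s); last by ring.
ring.
Qed.

End heat_potential.

(** * Continuity of integrals with an integrable kernel *)

Section continuity_under_kernel.
Variable R : realType.
Notation mu := (@lebesgue_measure R).

(** Joint continuity of [H] along the compact interval makes [H z s] close to
    [H z0 s] uniformly in [s] once [z] is close to [z0]; the difference of the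
    integrals is then small against the integral of [|k|].  Compactness enters
    through near-coverings, so [X] can be any topological space. *)
Lemma cvg_integral_kernel (X : topologicalType) (k : R -> R)
    (H : X -> R -> R) (c d : R) (z0 : X) :
  mu.-integrable `[c, d] (EFin \o k) ->
  (forall z, mu.-integrable `[c, d] (fun s => (k s * H z s)%:E)) ->
  (forall s, s \in `[c, d] -> H w.2 w.1 @[w --> (s, z0)] --> H z0 s) ->
  \int[mu]_(s in `[c, d]) (k s * H z s) @[z --> z0] -->
  \int[mu]_(s in `[c, d]) (k s * H z0 s).
Proof.
move=> ik iH cH; have mcd : measurable (`[c, d]%classic : set (measurableTypeR R)).
  exact: measurable_itv.
have ink : mu.-integrable `[c, d] (fun s => `|k s|%:E).
  exact: integrable_norm ik.
pose C := \int[mu]_(s in `[c, d]) `|k s|.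
have C0 : 0 <= C by exact: Rintegral_ge0.
have C1 : 0 < C + 1 by rewrite ltr_wpDl.
apply/cvgrPdist_le => e e0; pose dl := e / (C + 1).
have dl0 : 0 < dl by rewrite divr_gt0.
have near_unif : \forall z \near z0,
    `[c, d] `<=` [set s | `|H z0 s - H z s| <= dl].
  have /compact_near_coveringP cpt := @segment_compact R c d.
  apply: (cpt X (nbhs z0) (fun z s => `|H z0 s - H z s| <= dl)) => s cds.
  have dl2 : 0 < dl / 2 by rewrite divr_gt0.
  have /cvgrPdist_le /(_ _ dl2) [[A B]/= [nA nB] AB] := cH s cds.
  exists (A, B) => // -[s' z] [/= As Bz].
  have := AB (s', z0) (conj As (nbhs_singleton nB)).
  have := AB (s', z) (conj As Bz); rewrite /= => h1 h2.
  rewrite (_ : _ - _ = (H z0 s - H z s') - (H z0 s - H z0 s')); last by ring.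
  by rewrite (splitr dl) (le_trans (ler_normB _ _))// lerD.
near=> z; have zP : `[c, d] `<=` [set s | `|H z0 s - H z s| <= dl] by near: z.
have iD : mu.-integrable `[c, d] (EFin \o (fun s => k s * H z0 s - k s * H z s)).
  have := integrableB mcd (iH z0) (iH z).
  by apply: eq_integrable => // s _ /=; rewrite EFinB.
rewrite -RintegralB; [|exact: mcd|exact: iH|exact: iH].
apply: (le_trans (le_normr_Rintegral mcd iD)).
apply: (@le_trans _ _ (\int[mu]_(s in `[c, d]) (`|k s| * dl))).
  apply: le_Rintegral => //.
  - exact: integrable_norm iD.
  - have := integrableZr mcd dl ink.
    by apply: eq_integrable => // s _ /=.
  - move=> s /zP /= sP; rewrite -mulrBr normrM ler_wpM2l//.
rewrite RintegralZr// -/C /dl mulrA ler_pdivrMr// mulrC ler_pM2l//.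
by rewrite lerDl.
Unshelve. all: by end_near. Qed.

End continuity_under_kernel.

(** * Continuity of the potential *)

Section gauss_potential.
Variables (R : realType) (n : nat).
Notation mu := (@lebesgue_measure R).
Implicit Types (a c s t alpha : R) (x : 'rV[R]_n) (g : R -> R).

(** On a bounded interval [e^(-s)] is bounded below, so the Gamma integrand
    dominates the kernel. *)
Lemma integrable_rlker alpha c : 0 < alpha ->
  mu.-integrable `[0, c] (EFin \o rlker alpha).
Proof.
move=> al0; have m1 := @measurable_rlker R alpha.
have m2 : measurable_fun setT (fun s : measurableTypeR R =>
    rlker alpha s * expR (- s)).
  by apply: measurable_funM => //; apply: measurableT_comp.
have mI : measurable (`[0, c]%classic : set (measurableTypeR R)).
  exact: measurable_itv.
have iG : mu.-integrable setT (fun s => (rlker alpha s * expR (- s))%:E).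
  apply/integrableP; split; first exact/measurable_EFinP.
  rewrite (eq_integral (fun s : measurableTypeR R => (rlker alpha s * expR (- s))%:E)).
    exact: integral_Gamma_lty.
  by move=> s _; rewrite gee0_abs// lee_fin mulr_ge0 ?expR_ge0// rlker_ge0.
have := integrableZl mI (expR c) (integrableS measurableT mI (@subsetT _ _) iG).
apply: le_integrable => //.
  by apply/measurable_EFinP; apply: measurable_funTS.
move=> s /=; rewrite in_itv/= => /andP[s0 sc].
rewrite lee_fin ger0_norm ?rlker_ge0// mulrCA -expRD ger0_norm; last first.
  by rewrite mulr_ge0 ?expR_ge0 ?rlker_ge0.
by rewrite ler_peMr ?rlker_ge0// -[leLHS]expR0 ler_expR subr_ge0.
Qed.

Lemma heat_gauss_le1 a x s : 0 < a -> 0 <= s -> heat_gauss a x s <= 1.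
Proof.
move=> a0 s0; have as0 : 0 < a + s by rewrite ltr_wpDr.
rewrite mulr_ile1 ?expR_ge0 ?exprn_ge0 ?sqrtr_ge0//.
  rewrite exprn_ile1 ?sqrtr_ge0// -[leRHS]sqrtr1 ler_wsqrtr//.
  by rewrite ler_pdivrMr// mul1r lerDl.
rewrite -[leRHS]expR0 ler_expR oppr_le0 divr_ge0 ?mulr_ge0 ?(ltW as0)//.
by apply: sumr_ge0 => i _; exact: sqr_ge0.
Qed.

Lemma continuous_sqnorm : continuous (@sqnorm R n).
Proof.
move=> x; rewrite /sqnorm.
have cx i : (v : 'rV[R]_n) ord0 i ^+ 2 @[v --> x] --> x ord0 i ^+ 2.
  apply: (cvg_comp (fun v : 'rV[R]_n => v ord0 i) (fun y : R => y ^+ 2)).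
    exact: coord_continuous.
  exact: exprn_continuous.
have cs : (\sum_i (fun v : 'rV[R]_n => v ord0 i ^+ 2)) @ x --> \sum_i x ord0 i ^+ 2.
  elim/big_ind2 : _ => [|f1 l1 f2 l2 h1 h2|i _]; last exact: cx.
    exact: (@cvg_cst R 0 _ (nbhs x) _).
  exact: (cvgD h1 h2).
by move: cs; rewrite fct_sumE.
Qed.

Lemma cvg_heat_gauss T (F : set_system T) {FF : Filter F} a
    (X : T -> 'rV[R]_n) (S : T -> R) x s :
  a + s != 0 -> X @ F --> x -> S @ F --> s ->
  heat_gauss a (X w) (S w) @[w --> F] --> heat_gauss a x s.
Proof.
move=> as0 cX cS.
have cas : (a + S w) @[w --> F] --> a + s by apply: cvgD => //; exact: cvg_cst.
have cN : sqnorm (X w) @[w --> F] --> sqnorm x.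
  by apply: continuous_cvg => //; exact: continuous_sqnorm.
apply: cvgM.
  apply: (cvg_comp _ (fun y : R => y ^+ n)); last exact: exprn_continuous.
  apply: (cvg_comp _ (@Num.sqrt R)); last exact: sqrt_continuous.
  by apply: cvgM; [exact: cvg_cst|exact: cvgV].
apply: (cvg_comp _ (@expR R)); last exact: continuous_expR.
apply: cvgN; apply: cvgM => //; apply: cvgV; first by rewrite mulf_neq0.
by apply: cvgM => //; exact: cvg_cst.
Qed.

Section bounded_profile.
Variables (alpha a m : R) (g : R -> R).
Hypotheses (al0 : 0 < alpha) (a0 : 0 < a) (cg : continuous g).
Hypotheses (g0 : forall t, 0 <= g t) (gm : forall t, g t <= m).
Hypothesis gneg : forall t, t <= 0 -> g t = 0.

Let k s := rlker alpha s / Gamma alpha.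
Let H (z : 'rV[R]_n * R) s := g (z.2 - s) * heat_gauss a z.1 s.

Let mg : measurable_fun setT g.
Proof. exact: continuous_measurable_fun. Qed.

Let mH z : measurable_fun setT (H z).
Proof.
apply: measurable_funM; last exact: measurable_heat_gauss.
by apply: measurableT_comp => //; exact: measurable_funB.
Qed.

Let mk : measurable_fun setT k.
Proof. by apply: measurable_funM => //; exact: measurable_rlker. Qed.

Let k_ge0 s : 0 <= k s.
Proof. by rewrite divr_ge0 ?rlker_ge0// ltW// Gamma_gt0. Qed.

Let integrable_k c : mu.-integrable `[0, c] (EFin \o k).
Proof.
have mI : measurable (`[0, c]%classic : set (measurableTypeR R)).
  exact: measurable_itv.
have := integrableZr mI (Gamma alpha)^-1 (integrable_rlker c al0).
exact: eq_integrable.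
Qed.

Let integrable_kH c z : mu.-integrable `[0, c] (fun s => (k s * H z s)%:E).
Proof.
have mI : measurable (`[0, c]%classic : set (measurableTypeR R)).
  exact: measurable_itv.
have := integrableZl mI m (integrable_k c); apply: le_integrable => //.
  by apply/measurable_EFinP; apply: measurable_funTS; exact: (measurable_funM mk (mH z)).
move=> s /=; rewrite in_itv/= => /andP[s0 sc].
have H0 : 0 <= H z s by rewrite mulr_ge0// heat_gauss_ge0.
have m0 : 0 <= m by rewrite (le_trans (g0 0)).
have kH0 : 0 <= k s * H z s by rewrite mulr_ge0.
have mk0 : 0 <= m * k s by rewrite mulr_ge0.
rewrite lee_fin (ger0_norm kH0) (ger0_norm mk0) mulrC ler_wpM2r//.
rewrite /H -[leRHS]mulr1 ler_pM ?heat_gauss_ge0//.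
exact: heat_gauss_le1.
Qed.

(** Since [g] vanishes at nonpositive times, the integral stops at the current
    time.  A bound [c] common to all [z] near a given point gives an interval
    that does not move with [z].  The equality also says that the potential is
    finite. *)
Lemma J_gauss_itv c z : z.2 <= c ->
  (J alpha (gauss_source a g) z = (\int[mu]_(s in `[0, c]) (k s * H z s))%:E)%E.
Proof.
case: z => x t /= tc; rewrite J_gauss//.
have mI : measurable (`[0, c]%classic : set (measurableTypeR R)).
  exact: measurable_itv.
rewrite /Rintegral fineK; last exact: integrable_fin_num (integrable_kH c (x, t)).
rewrite [RHS]integral_mkcond; apply: eq_integral => s _.
rewrite patchE; case: ifPn => //; rewrite notin_setE/= in_itv/= => /negP.
rewrite negb_and -!ltNge => /orP[s0|cs].
  by rewrite rlker_le0E ?mul0r// ltW.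
by rewrite gneg ?mul0r ?mulr0// subr_le0 ltW// (le_lt_trans tc).
Qed.

Lemma continuous_J_gauss :
  continuous (fun z : 'rV[R]_n * R => fine (J alpha (gauss_source a g) z)).
Proof.
move=> z0; pose c := z0.2 + 1.
have z0c : z0.2 < c by rewrite ltrDl.
rewrite /continuous_at (J_gauss_itv (ltW z0c))/=.
apply: (cvg_trans _ (cvg_integral_kernel (integrable_k c)
    (integrable_kH c) (z0 := z0) _)).
  apply: near_eq_cvg; near=> z; rewrite (@J_gauss_itv c)//.
  near: z; apply: (@cvgr_le _ _ _ _ snd z0.2) => //; exact: cvg_snd.
move=> s; rewrite in_itv/= => /andP[s0 _].
have cw : w @[w --> (s, z0)] --> (s, z0) by exact: cvg_id.
have c2 : w.2 @[w --> (s, z0)] --> z0 by exact: cvg_snd.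
have c1 : w.1 @[w --> (s, z0)] --> s by exact: cvg_fst.
have c22 : w.2.2 @[w --> (s, z0)] --> z0.2 by exact: (cvg_comp _ _ c2 cvg_snd).
have c21 : w.2.1 @[w --> (s, z0)] --> z0.1 by exact: (cvg_comp _ _ c2 cvg_fst).
apply: cvgM; last by apply: cvg_heat_gauss => //; rewrite gt_eqF// ltr_wpDr.
by apply: continuous_cvg; [exact: cg|exact: cvgB].
Unshelve. all: by end_near. Qed.

End bounded_profile.

End gauss_potential.

(** * Integrability of Gaussian sources *)

Section gauss_source_Lp.
Variables (R : realType) (n : nat).
Notation mu := (@lebesgue_measure R).
Implicit Types (a c m p : R) (g : R -> R).

Lemma measurable_gauss_source a g : measurable_fun setT g ->
  measurable_fun setT (@gauss_source R n a g).
Proof.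
move=> mg.
have m1 : measurable_fun setT (fst : 'rV[R]_n * measurableTypeR R -> _).
  exact: measurable_fst.
have m2 : measurable_fun setT (snd : 'rV[R]_n * measurableTypeR R -> _).
  exact: measurable_snd.
apply: measurable_funM; first exact: (measurableT_comp mg m2).
apply: measurableT_comp => //; apply: measurable_funN; apply: measurable_funM => //.
exact: (measurableT_comp (@measurable_sqnorm R n) m1).
Qed.

(** The power [p] of the Gaussian of parameter [a] is the one of parameter
    [a / p]. *)
Lemma integral_gauss_powR a p : 0 < a -> 0 < p ->
  (\int[lebesgue_rV R n]_x (expR (- (sqnorm x / (4 * a))) `^ p)%:E =
   (Num.sqrt (4 * pi * (a / p)) ^+ n)%:E)%E.
Proof.
move=> a0 p0; have ap0 : 0 < a / p by rewrite divr_gt0.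
have := @integral_rV_prod R n (fun _ y => expR (- ((y - 0) ^+ 2 / (4 * (a / p)))))
  (fun _ => Num.sqrt (4 * pi * (a / p))) _ _ _.
rewrite prodr_const card_ord => <-.
- apply: eq_integral => x _; congr EFin.
  rewrite -expR_sum sumrN -mulr_suml -expRM; congr expR.
  under eq_bigr do rewrite subr0.
  by rewrite /sqnorm; field; rewrite !gt_eqF.
- move=> _; apply: measurableT_comp => //; apply: measurable_funN.
  apply: measurable_funM => //; apply: measurable_funX; exact: measurable_funB.
- by move=> _ y; exact: expR_ge0.
- by move=> _; exact: integral_gauss.
Qed.

(** The p-th power of the source separates into a Gaussian in space and a
    bounded function of compact support in time. *)
Lemma finite_norm_gauss_source p a m c g : 1 <= p -> 0 < a ->
  measurable_fun setT g -> (forall t, 0 <= g t <= m) ->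
  (forall t, t \notin `[0, c] -> g t = 0) ->
  finite_norm (lebesgue_st R n) p%:E (gauss_source a g).
Proof.
move=> p1 a0 mg g0m gc; have p0 : 0 < p by rewrite (lt_le_trans ltr01).
have g0 t : 0 <= g t by have /andP[] := g0m t.
have m0 : 0 <= m by rewrite (le_trans (g0 0))//; have /andP[] := g0m 0.
have mgp : measurable_fun setT (fun t => g t `^ p).
  exact: (measurableT_comp (measurable_powR p)).
have mI : measurable (`[0, c]%classic : set (measurableTypeR R)).
  exact: measurable_itv.
pose C := Num.sqrt (4 * pi * (a / p)) ^+ n.
have C0 : 0 <= C by rewrite exprn_ge0// sqrtr_ge0.
pose G (x : 'rV[R]_n) := expR (- (sqnorm x / (4 * a))) `^ p.
have mG : measurable_fun setT G.
  apply: (measurableT_comp (measurable_powR p)); apply: measurableT_comp => //.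
  apply: measurable_funN; apply: measurable_funM => //; exact: measurable_sqnorm.
rewrite /finite_norm unlock; apply: poweR_lty.
rewrite (eq_integral (fun w : 'rV[R]_n * measurableTypeR R =>
    (g w.2 `^ p)%:E * (G w.1)%:E)%E); last first.
  move=> w _ /=; rewrite /G -EFinM -powRM ?expR_ge0//.
  by rewrite ger0_norm// mulr_ge0// expR_ge0.
rewrite /lebesgue_st fubini_tonelli2; last 2 first.
- apply: emeasurable_funM; apply/measurable_EFinP.
    exact: (measurableT_comp mgp measurable_snd).
  exact: (measurableT_comp mG measurable_fst).
- by move=> w; rewrite mule_ge0// lee_fin powR_ge0.
rewrite (eq_integral (fun t : measurableTypeR R => (g t `^ p)%:E * C%:E)%E); last first.
  move=> t _; rewrite /fubini_G/= ge0_integralZl ?lee_fin ?powR_ge0//; last 2 first.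
  - exact/measurable_EFinP.
  - by move=> x _; rewrite lee_fin powR_ge0.
  by rewrite integral_gauss_powR.
rewrite ge0_integralZr ?lee_fin//; last 2 first.
- exact/measurable_EFinP.
- by move=> t _; rewrite lee_fin powR_ge0.
rewrite muleC; apply: lte_mul_pinfty => //.
have gle : (\int[mu]_t (g t `^ p)%:E <= \int[mu]_(t in `[0%R, c]) (m `^ p)%:E)%E.
  rewrite [leRHS]integral_mkcond; apply: ge0_le_integral => //.
  - by move=> t _; rewrite lee_fin powR_ge0.
  - exact/measurable_EFinP.
  - by apply/(measurable_restrictT _ _).1 => //; exact: measurable_cst.
  - move=> t _; rewrite patchE mem_setE; case: ifPn => tc.
      by rewrite lee_fin ge0_ler_powR ?nnegrE ?(ltW p0)//; have /andP[] := g0m t.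
    by rewrite gc// powR0// gt_eqF.
apply: (le_lt_trans gle); rewrite integral_cst//= lebesgue_measure_itv/= -EFinB.
by case: ifPn => _; rewrite ?mule0// -EFinM ltry.
Qed.

End gauss_source_Lp.

(** * Lower bound for the potential and the time profile *)

Section lower_bound.
Variables (R : realType) (n : nat).
Notation mu := (@lebesgue_measure R).
Implicit Types (a b s t alpha : R) (x : 'rV[R]_n) (g : R -> R).

Lemma bernoulli_subr (y : R) k : 0 <= y <= 1 -> 1 - k%:R * y <= (1 - y) ^+ k.
Proof.
move=> /andP[y0 y1]; elim: k => [|k IHk]; first by rewrite mul0r subr0 expr0.
rewrite exprS; apply: (@le_trans _ _ ((1 - y) * (1 - k%:R * y))); last first.
  by rewrite ler_wpM2l// subr_ge0.
have k0 : 0 <= k%:R * y ^+ 2 by rewrite mulr_ge0// sqr_ge0.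
rewrite -natr1 -subr_ge0; apply: le_trans k0 _; rewrite le_eqVlt; apply/orP; left.
by apply/eqP; ring.
Qed.

(** The Gaussian only widens, so its exponential factor increases; the loss is
    the amplitude [sqrt (a / (a + s))^n >= (1 - s / (a + s))^n], which
    Bernoulli's inequality bounds below. *)
Lemma heat_gauss_ge a x s : 0 < a -> 0 <= s ->
  (1 - n%:R * (s / a)) * expR (- (sqnorm x / (4 * a))) <= heat_gauss a x s.
Proof.
move=> a0 s0; have as0 : 0 < a + s by rewrite ltr_wpDr.
have sas : s / (a + s) <= s / a.
  by rewrite ler_wpM2l// lef_pV2 ?posrE// lerDl.
have sas1 : s / (a + s) <= 1 by rewrite ler_pdivrMr// mul1r lerDr ltW.
have sas0 : 0 <= s / (a + s) by rewrite divr_ge0// ltW.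
have aE : a / (a + s) = 1 - s / (a + s) by field; rewrite gt_eqF.
have e0 : 0 <= expR (- (sqnorm x / (4 * a))) by exact: expR_ge0.
have sq0 : 0 <= sqnorm x by apply: sumr_ge0 => i _; exact: sqr_ge0.
apply: (@le_trans _ _ ((a / (a + s)) ^+ n * expR (- (sqnorm x / (4 * a))))).
  rewrite ler_wpM2r// aE.
  apply: (le_trans _ (bernoulli_subr n _)); last by rewrite sas0.
  by rewrite lerB// ler_wpM2l.
rewrite /heat_gauss ler_pM//.
- by rewrite exprn_ge0// divr_ge0// ltW.
- have q0 : 0 <= a / (a + s) by rewrite divr_ge0// ltW.
  rewrite lerXn2r ?nnegrE ?sqrtr_ge0// -{1}(sqr_sqrtr q0) expr2.
  rewrite ler_piMr ?sqrtr_ge0// -[leRHS]sqrtr1 ler_wsqrtr//.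
  by rewrite aE gerBl.
- rewrite ler_expR lerN2 ler_wpM2l// lef_pV2 ?posrE ?mulr_gt0//.
  by rewrite ler_pM2l// lerDl.
Qed.

(** A lower bound of the integrand by a power of [t - s] turns the potential
    into the convolution of two Riemann-Liouville kernels, which is explicit. *)
Lemma J_gauss_ge alpha a b (D : R) g x t : 0 < alpha -> 0 < a -> 0 < b ->
  measurable_fun setT g -> (forall s, 0 <= g s) -> 0 <= D -> 0 < t ->
  (forall s, 0 < s < t -> D * (t - s) `^ (b - 1) <= g (t - s) * heat_gauss a x s) ->
  ((D * (Gamma b / Gamma (alpha + b)) * t `^ (alpha + b - 1))%:E <=
   J alpha (gauss_source a g) (x, t))%E.
Proof.
move=> al0 a0 b0 mg g0 D0 t0 Dg; have G0 := Gamma_gt0 al0.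
have Gab := Gamma_gt0 (addr_gt0 al0 b0).
have rl0 := @rlker_ge0 R.
have DG0 : 0 <= D / Gamma alpha by exact: (divr_ge0 D0 (ltW G0)).
have msub : measurable_fun setT (fun s : R => t - s) by exact: measurable_funB.
have mconv : measurable_fun setT
    (fun s : measurableTypeR R => (rlker b (t - s) * rlker alpha s)%:E).
  apply/measurable_EFinP; apply: measurable_funM; last exact: measurable_rlker.
  exact: (measurableT_comp (@measurable_rlker R b)).
rewrite J_gauss//.
apply: (@le_trans _ _ (\int[mu]_s ((D / Gamma alpha)%:E *
    (rlker b (t - s) * rlker alpha s)%:E))%E).
  rewrite ge0_integralZl//; last by move=> s _; rewrite lee_fin mulr_ge0.
  rewrite rlker_conv// -EFinM lee_fin rlker_gt0E// [b + alpha]addrC.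
  have E (u v w y : R) : u != 0 -> w != 0 ->
      D * (v / w) * y = D / u * (y * (v * u / w)).
    by move=> u0 w0; field; rewrite u0 w0.
  by rewrite (E _ _ _ _ (lt0r_neq0 G0) (lt0r_neq0 Gab)).
apply: ge0_le_integral => //.
- by move=> s _; rewrite -EFinM lee_fin mulr_ge0// mulr_ge0.
- exact: measurable_funeM.
- apply/measurable_EFinP; apply: measurable_funM.
    by apply: measurable_funM => //; exact: measurable_rlker.
  by apply: measurable_funM; [exact: measurableT_comp|exact: measurable_heat_gauss].
move=> s _; rewrite -EFinM lee_fin.
rewrite [leLHS](_ : _ = rlker alpha s / Gamma alpha * (D * rlker b (t - s)));
  last by ring.
have [s0|s0] := leP s 0; first by rewrite rlker_le0E// !mul0r.
rewrite ler_wpM2l ?divr_ge0 ?(ltW G0)//.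
have [ts|st] := leP t s.
  by rewrite rlker_le0E ?subr_le0// mulr0 mulr_ge0// heat_gauss_ge0.
by rewrite rlker_gt0E ?subr_gt0// Dg// s0.
Qed.

End lower_bound.

Section profile.
Variable R : realType.
Implicit Types (b c t T : R).

(** The maximum with 0 is needed because [x `^ c] is 1 for negative [x]. *)
Lemma continuous_pospart_powR c : 0 < c ->
  continuous (fun t => Num.max t 0 `^ c).
Proof.
move=> c0 t; have [t0|t0|->] := ltgtP t 0.
- apply: (near_cst_continuous 0); near=> y.
  rewrite max_r ?powR0 ?gt_eqF//; apply: ltW; near: y.
  by apply: (cvgr_lt t) => //; exact: cvg_id.
- have ct : {for t, continuous (fun y : R => y `^ c)}.
    apply: differentiable_continuous; apply/derivable1_diffP.
    by apply: derivable_powR; rewrite in_itv/= andbT.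
  rewrite /continuous_at max_l ?(ltW t0)//; apply: cvg_trans ct.
  apply: near_eq_cvg; near=> y; rewrite max_l//; apply: ltW; near: y.
  by apply: (cvgr_gt t) => //; exact: cvg_id.
- rewrite /continuous_at maxxx powR0 ?gt_eqF//.
  apply/cvgr0Pnorm_le => e e0; near=> y.
  rewrite ger0_norm ?powR_ge0//; have [y0|y0] := leP y 0.
    by rewrite powR0 ?gt_eqF// ltW.
  (* [y^c <= e] as soon as [y] is below the c-th root of [e]. *)
  have ec : e = (e `^ c^-1) `^ c by rewrite -powRrM mulVf ?gt_eqF// powRr1 // ltW.
  rewrite ec ge0_ler_powR ?nnegrE ?powR_ge0 ?(ltW c0) ?(ltW y0)//.
  apply: ltW; near: y.
  by apply: (cvgr_lt (0 : R)); [exact: cvg_id|exact: powR_gt0].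
Unshelve. all: by end_near. Qed.

Definition cutoff T t : R := Num.max 0 (Num.min 1 (2 - t / T)).

Lemma cutoff_ge0 T t : 0 <= cutoff T t.
Proof. by rewrite /cutoff le_max lexx. Qed.

Lemma cutoff_le1 T t : cutoff T t <= 1.
Proof. by rewrite /cutoff ge_max ler01 ge_min lexx. Qed.

Lemma cutoff_eq1 T t : 0 < T -> t <= T -> cutoff T t = 1.
Proof.
move=> T0 tT; have tT1 : t / T <= 1 by rewrite ler_pdivrMr// mul1r.
by rewrite /cutoff min_l ?max_r//; lra.
Qed.

Lemma cutoff_eq0 T t : 0 < T -> 2 * T <= t -> cutoff T t = 0.
Proof.
move=> T0 tT; have tT2 : 2 <= t / T by rewrite ler_pdivlMr.
by rewrite /cutoff max_l// ge_min; apply/orP; right; lra.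
Qed.

Lemma cutoff_nincr T t s : 0 < T -> s <= t -> cutoff T t <= cutoff T s.
Proof.
move=> T0 st; have : s / T <= t / T by rewrite ler_wpM2r// invr_ge0 ltW.
move=> h; rewrite /cutoff ge_max !le_max lexx/= ; apply/orP; right.
by rewrite le_min !ge_min lexx/=; apply/orP; right; lra.
Qed.

Lemma continuous_cutoff T : continuous (cutoff T).
Proof.
have c1 : continuous (fun t : R => 2 - t / T).
  move=> t; apply: cvgB; first exact: cvg_cst.
  by apply: cvgM; [exact: cvg_id|exact: cvg_cst].
have c2 : continuous ((cst 1 : R -> R^o) \min (fun t : R => 2 - t / T)).
  by move=> t; apply: continuous_min; [exact: cst_continuous|exact: c1].
have c3 : continuous ((cst 0 : R -> R^o) \max
    ((cst 1 : R -> R^o) \min (fun t : R => 2 - t / T))).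
  by move=> t; apply: continuous_max; [exact: cst_continuous|exact: c2].
exact: c3.
Qed.

End profile.

(** * The solution *)

Theorem theorem3p3 (R : realType) (n : nat) (p alpha lambda T N : R) :
  (0 < n)%N ->
  (1 < p /\ 0 < alpha < (n%:R + 2) / (2 * p)) \/
  (p = 1 /\ 0 < alpha <= (n%:R + 2) / (2 * p)) ->
  0 < lambda < 1 ->
  0 < T ->
  0 < N < Mconst alpha lambda ->
  exists u : 'rV[R]_n * R -> R,
    [/\ Yspace p alpha u, continuous u &
    exists f : 'rV[R]_n * R -> R,
      [/\ is_frac_heat p alpha u f,
          (forall z, 0 <= f z <= u z `^ lambda) /\
          (forall (x : 'rV[R]_n) (t : R), t < 0 -> u (x, t) = 0),
          f \in Lfun (lebesgue_st R n) p%:E /\ continuous f,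
          forall t : R, 0 < t < T ->
            (N * t `^ alpha) `^ (1 / (1 - lambda)) <= u (0, t)
        & forall t : R, 0 < t < T ->
            f (0, t) = (N * t `^ alpha) `^ (lambda / (1 - lambda))]].
Proof.
move=> n0 palpha /andP[l0 l1] T0 /andP[N0 NM].
have [p1 al0] : 1 <= p /\ 0 < alpha.
  by case: palpha => -[p1 /andP[al0 _]]; split=> //; [exact: ltW|rewrite p1].
have ol0 : 0 < 1 - lambda by rewrite subr_gt0.
have oln0 := lt0r_neq0 ol0.
pose q := lambda / (1 - lambda); pose b := alpha * lambda / (1 - lambda).
pose r := 1 / (1 - lambda).
have q0 : 0 < q by rewrite divr_gt0.
have b0 : 0 < b by rewrite divr_gt0// mulr_gt0.
have r0 : 0 < r by rewrite divr_gt0.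
have qr : q = r * lambda by rewrite /q /r; field.
have rq : r = q + 1 by rewrite /q /r; field.
have bq : b = alpha * q by rewrite /q /b; field.
set M := Mconst alpha lambda in NM.
have M0 : 0 < M := lt_trans N0 NM.
have ME : M = Gamma (b + 1) / Gamma (alpha + (b + 1)) by rewrite addrA.
clearbody M.
have e0 : 0 < 1 - N / M by rewrite subr_gt0 ltr_pdivrMr// mul1r.
have nR0 : 0 < n%:R :> R by rewrite ltr0n.
(* The width for which [heat_gauss_ge] loses exactly the factor [N / M] at time
   [2 * T]. *)
pose a := n%:R * (2 * T) / (1 - N / M).
have a0 : 0 < a by rewrite divr_gt0// !mulr_gt0.
pose g t := N `^ q * Num.max t 0 `^ b * cutoff T t.
have Nq0 : 0 <= N `^ q by exact: powR_ge0.
have g0 t : 0 <= g t by rewrite !mulr_ge0 ?powR_ge0 ?cutoff_ge0.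
have gE t : 0 < t -> g t = (N * t `^ alpha) `^ q * cutoff T t.
  move=> t0; rewrite /g max_l ?(ltW t0)//.
  by rewrite powRM ?powR_ge0 ?(ltW N0)// -powRrM -bq.
have gneg t : t <= 0 -> g t = 0.
  by move=> t0; rewrite /g max_r// powR0 ?gt_eqF// mulr0 mul0r.
have gbig t : 2 * T <= t -> g t = 0.
  by move=> tT; rewrite /g cutoff_eq0// mulr0.
have cg : continuous g.
  move=> t; apply: cvgM; last exact: continuous_cutoff.
  by apply: cvgM; [exact: cvg_cst|exact: continuous_pospart_powR].
have mg := continuous_measurable_fun cg.
pose m := N `^ q * (2 * T) `^ b.
have m0 : 0 <= m by rewrite mulr_ge0// powR_ge0.
have gm t : g t <= m.
  have [tT|tT] := leP (2 * T) t; first by rewrite gbig.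
  rewrite -[leRHS]mulr1 ler_pM ?cutoff_ge0 ?cutoff_le1 ?mulr_ge0 ?powR_ge0//.
  rewrite ler_wpM2l// ge0_ler_powR ?nnegrE ?(ltW b0)//.
  - by rewrite le_max lexx orbT.
  - by rewrite mulr_ge0// ltW.
  - by rewrite ge_max (ltW tT) mulr_ge0// ltW.
pose f : 'rV[R]_n * R -> R := gauss_source a g.
pose u (z : 'rV[R]_n * R) := fine (J alpha f z).
have Jfin z : (J alpha f z = (u z)%:E)%E.
  by rewrite /u /f (J_gauss_itv al0 a0 cg g0 gm gneg (lexx z.2)).
have u0 z : 0 <= u z.
  rewrite -lee_fin -Jfin; case: z => x t; rewrite J_gauss//.
  apply: integral_ge0 => s _; rewrite lee_fin; apply: mulr_ge0.
    exact: divr_ge0 (rlker_ge0 _ _) (ltW (Gamma_gt0 al0)).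
  by apply: mulr_ge0; [exact: g0|exact: heat_gauss_ge0].
have fin_source (g' : R -> R) : measurable_fun setT g' ->
    (forall t, 0 <= g' t <= g t) ->
    finite_norm (lebesgue_st R n) p%:E (gauss_source a g').
  move=> mg' g'g; apply: (@finite_norm_gauss_source _ _ _ _ m (2 * T)) => //.
    by move=> t; have /andP[-> h] := g'g t; rewrite (le_trans h).
  move=> t; rewrite in_itv/= negb_and -!ltNge => tT.
  apply/eqP; rewrite eq_le; have /andP[-> h] := g'g t; rewrite andbT (le_trans h)//.
  by case/orP: tT => tT; [rewrite gneg ?(ltW tT)|rewrite gbig ?(ltW tT)].
have mf : measurable_fun setT f by exact: measurable_gauss_source.
have heat : is_frac_heat p alpha u f.
  split; last by apply: aeW => z; rewrite Jfin.
  split=> // S.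
  (* A truncation in time of a Gaussian source is again a Gaussian source. *)
  have -> : f \_ (@before R n S) =
      gauss_source a (fun t => g t * \1_(`]-oo, S[ : set R) t).
    apply/funext => -[x t]; rewrite patchE /f /gauss_source /= indicE /before.
    have [tS|tS] := ltP t S.
      by rewrite mem_set// mem_set/= ?in_itv//= mulr1.
    rewrite memNset/=; last by rewrite /= ltNge tS => -[].
    by rewrite memNset/= ?in_itv/= ?ltNge ?tS// mulr0 mul0r.
  apply: fin_source => [|t].
    by apply: measurable_funM => //; apply: measurable_indic; exact: measurable_itv.
  by rewrite indicE; case: (_ \in _); rewrite ?mulr1 ?mulr0 ?lexx ?g0.
(* Diffusion costs [N / M], the Beta integral gives back [M]. *)
have fu_ge x t : 0 < t < 2 * T ->
    (N * t `^ alpha) `^ r * (cutoff T t * expR (- (sqnorm x / (4 * a)))) <=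
    u (x, t).
  move=> /andP[t0 tT]; set ph := expR _.
  have ph0 : 0 <= ph by exact: expR_ge0.
  pose D := N `^ q * (N / M) * (cutoff T t * ph).
  have NMge0 : 0 <= N / M by rewrite divr_ge0 ?(ltW N0) ?(ltW M0).
  have D0 : 0 <= D by apply: mulr_ge0; apply: mulr_ge0 => //; exact: cutoff_ge0.
  have b10 : 0 < b + 1 by rewrite addr_gt0.
  have := @J_gauss_ge R n alpha a (b + 1) D g x t al0 a0 b10 mg g0 D0 t0.
  rewrite -/f Jfin lee_fin -ME => H; apply: le_trans (H _).
    have Nt0 : 0 <= t `^ alpha by exact: powR_ge0.
    rewrite powRM ?(ltW N0)// -powRrM.
    have -> : alpha * r = alpha + (b + 1) - 1 by rewrite bq rq; ring.
    rewrite rq (@powRD _ N q 1) ?(gt_eqF N0) ?implybT// powRr1 ?(ltW N0)//.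
    rewrite /D le_eqVlt; apply/orP; left; apply/eqP; field; exact: lt0r_neq0.
  move=> s /andP[s0 st]; have ts0 : 0 < t - s by rewrite subr_gt0.
  rewrite addrK /D /g max_l ?(ltW ts0)//.
  have cts : cutoff T t <= cutoff T (t - s).
    by apply: cutoff_nincr; rewrite ?gerBl ?ltW.
  have hN : N / M * ph <= heat_gauss a x s.
    apply: le_trans (heat_gauss_ge x a0 (ltW s0)); rewrite ler_wpM2r//.
    have : n%:R * (s / a) <= 1 - N / M.
      rewrite /a mulrA ler_pdivrMr// mulrCA divff ?gt_eqF// mulr1.
      by rewrite ler_wpM2l ?(ltW nR0)// ltW// (lt_trans st).
    by lra.
  rewrite [leLHS](_ : _ = N `^ q * (t - s) `^ b * (cutoff T t * (N / M * ph)));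
    last by ring.
  rewrite -[leRHS]mulrA ler_wpM2l ?mulr_ge0 ?powR_ge0//.
  by apply: ler_pM => //; [exact: cutoff_ge0|exact: mulr_ge0].
exists u; split.
- by exists f.
- exact: (continuous_J_gauss al0 a0 cg g0 gm gneg).
exists f; split => //.
- split=> [[x t]|x t t0]; last first.
    rewrite /u /f (@J_gauss_itv _ _ _ _ _ _ al0 a0 cg g0 gm gneg 0)/= ?(ltW t0)//.
    by rewrite set_itv1 Rintegral_set1.
  rewrite /f /gauss_source /= mulr_ge0 ?expR_ge0//=.
  set ph := expR _.
  have [t0|t0] := leP t 0; first by rewrite gneg// mul0r powR_ge0.
  have [tT|tT] := leP (2 * T) t; first by rewrite gbig// mul0r powR_ge0.
  have tt : 0 < t < 2 * T by rewrite t0.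
  have P0 : 0 <= (N * t `^ alpha) `^ r by exact: powR_ge0.
  have y0 : 0 <= cutoff T t * ph by rewrite mulr_ge0 ?cutoff_ge0 ?expR_ge0.
  apply: (@le_trans _ _ (((N * t `^ alpha) `^ r * (cutoff T t * ph)) `^ lambda)).
    rewrite powRM// -powRrM -qr gE// -mulrA ler_wpM2l ?powR_ge0//.
    have [->|yn0] := eqVneq (cutoff T t * ph) 0; first exact: powR_ge0.
    (* [y <= y^lambda] for [y = cutoff T t * ph] in (0, 1]. *)
    apply: ger1_powR; last exact: ltW.
    rewrite lt_def yn0 y0/= mulr_ile1 ?cutoff_ge0 ?cutoff_le1 ?expR_ge0//.
    rewrite -[leRHS]expR0 ler_expR oppr_le0 divr_ge0//.
      by apply: sumr_ge0 => i _; exact: sqr_ge0.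
    by rewrite mulr_ge0 ?(ltW a0).
  by apply: ge0_ler_powR; rewrite ?nnegrE ?(ltW l0)//;
    [exact: mulr_ge0|exact: fu_ge].
- split.
    rewrite inE/=; apply/andP; split; rewrite inE//=.
    by apply: fin_source => // t; rewrite g0 lexx.
  move=> z; apply: cvgM.
    by apply: (cvg_comp snd g); [exact: cvg_snd|exact: cg].
  apply: (cvg_comp _ (@expR R)); last exact: continuous_expR.
  apply: cvgN; apply: cvgM; last exact: cvg_cst.
  by apply: (cvg_comp fst (@sqnorm R n)); [exact: cvg_fst|exact: continuous_sqnorm].
- move=> t /andP[t0 tT].
  have t2 : 0 < t < 2 * T by rewrite t0/=; lra.
  have := fu_ge 0 t t2; rewrite cutoff_eq1 ?(ltW tT)// mul1r.
  rewrite (_ : sqnorm 0 = 0) ?mul0r ?oppr0 ?expR0 ?mulr1//.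
  by rewrite /sqnorm big1// => i _; rewrite mxE expr0n.
- move=> t /andP[t0 tT].
  rewrite /f /gauss_source /= gE// cutoff_eq1 ?(ltW tT)// mulr1.
  rewrite (_ : sqnorm 0 = 0) ?mul0r ?oppr0 ?expR0 ?mulr1//.
  by rewrite /sqnorm big1// => i _; rewrite mxE expr0n.
Qed.
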